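(* Let $(\mathcal{N},\mathcal{I})$ be a $k$-extendible system with rank $r$ on a ground set of size $n$, let $f:2^{\mathcal{N}}\to\mathbb{R}_{\ge 0}$ be non-negative submodular, and run the algorithm SimultaneousGreedys with $\ell=k+1$ solutions. Then the algorithm makes $O(k^2 r n)$ calls to the value and independence oracles and outputs an independent set $S$ with $f(S)\ge \frac{k}{(k+1)^2} f(OPT)$, i.e., its approximation ratio is at most $(k+1)^2/k = k+O(1)$. Moreover, when $f$ is non-negative monotone submodular, the approximation ratio improves to $k+1$, i.e., $f(S)\ge f(OPT)/(k+1)$.
   Context: $\mathcal{N}$ is a finite ground set of size $n$. A set function $f$ is submodular if $f(X\cup Y)+f(X\cap Y)\le f(X)+f(Y)$ for all $X,Y\subseteq\mathcal{N}$, and monotone if $f(A)\le f(B)$ for $A\subseteq B$; write $f(u\mid S)=f(S\cup\{u\})-f(S)$ and $S+u=S\cup\{u\}$. An independence system $(\mathcal{N},\mathcal{I})$ is a non-empty family $\mathcal{I}\subseteq 2^{\mathcal{N}}$ closed under taking subsets. It is $k$-extendible if for all independent $A\subseteq B\in\mathcal{I}$ and $u\notin B$ with $A+u\in\mathcal{I}$ there is $Y\subseteq B\setminus A$ with $|Y|\le k$ and $(B\setminus Y)\cup\{u\}\in\mathcal{I}$. The rank $r$ is the maximum size of an independent set. It is assumed that $\{u\}\in\mathcal{I}$ for every $u\in\mathcal{N}$. $OPT$ denotes a set in $\mathcal{I}$ maximizing $f$. The algorithm accesses $f$ only through a value oracle (returns $f(S)$) and $\mathcal{I}$ only through an independence oracle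 (decides whether $S\in\mathcal{I}$). SimultaneousGreedys$(\mathcal{N},f,\mathcal{I},\ell)$: initialize $S^{(j)}_0=\varnothing$ for $j=1,\dots,\ell$ and $\mathcal{N}_0=\mathcal{N}$. At iteration $i=1,2,\dots$, let $\mathcal{A}_i$ be the set of pairs $(u,j)$ with $u\in\mathcal{N}_{i-1}$, $j\in\{1,\dots,\ell\}$, $S^{(j)}_{i-1}+u\in\mathcal{I}$ and $f(u\mid S^{(j)}_{i-1})>0$. If $\mathcal{A}_i=\varnothing$, stop. Otherwise choose $(u_i,j_i)\in\mathcal{A}_i$ maximizing $f(u\mid S^{(j)}_{i-1})$, set $S^{(j_i)}_i=S^{(j_i)}_{i-1}+u_i$, $S^{(j)}_i=S^{(j)}_{i-1}$ for $j\ne j_i$, and $\mathcal{N}_i=\mathcal{N}_{i-1}-u_i$. On termination, output the set maximizing $f$ among the $\ell$ final solutions. *)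

(* Defs.v *)
From HB Require Import structures.
From mathcomp Require Import all_boot all_order all_algebra.

Set Implicit Arguments.
Unset Strict Implicit.
Unset Printing Implicit Defensive.

Import Order.TTheory GRing.Theory Num.Theory.
Local Open Scope ring_scope.

Definition nonnegative (R : realFieldType) (T : finType) (f : {set T} -> R) :=
  forall A, 0 <= f A.

Definition submodular (R : realFieldType) (T : finType) (f : {set T} -> R) :=
  forall A B, f (A :|: B) + f (A :&: B) <= f A + f B.

Definition monotone (R : realFieldType) (T : finType) (f : {set T} -> R) :=
  forall A B : {set T}, A \subset B -> f A <= f B.

Definition independence_system (T : finType) (I : {set {set T}}) :=
  I != set0 /\ forall A B : {set T}, A \subset B -> B \in I -> A \in I.

Definition k_extendible (T : finType) (k : nat) (I : {set {set T}}) :=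
  independence_system I /\
  forall (A B : {set T}) (u : T),
    A \subset B -> B \in I -> u \notin B -> u |: A \in I ->
    exists Y : {set T},
      [/\ Y \subset B :\: A, (#|Y| <= k)%N & u |: (B :\: Y) \in I].

Definition rank (T : finType) (I : {set {set T}}) : nat :=
  \max_(A in I) #|A|.

Definition is_opt (R : realFieldType) (T : finType) (f : {set T} -> R)
    (I : {set {set T}}) (OPT : {set T}) :=
  OPT \in I /\ forall A, A \in I -> f A <= f OPT.

(** A program cannot mention f or I: it learns about them only through the
    queries [AskValue] and [AskIndep]. [Choose s q] picks an arbitrary member
    of s; it models unspecified tie-breaking and costs no oracle call. *)

Inductive prog (R : Type) (T : finType) (A : Type) : Type :=
| Ret of A
| AskValue of {set T} & (R -> prog R T A)
| AskIndep of {set T} & (bool -> prog R T A)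
| Choose (B : eqType) of seq B & (B -> prog R T A).

Arguments Ret {R T A}.
Arguments AskValue {R T A}.
Arguments AskIndep {R T A}.
Arguments Choose {R T A B}.

Fixpoint bind (R : Type) (T : finType) (A B : Type)
    (p : prog R T A) (g : A -> prog R T B) : prog R T B :=
  match p with
  | Ret a => g a
  | AskValue X q => AskValue X (fun v => bind (q v) g)
  | AskIndep X q => AskIndep X (fun b => bind (q b) g)
  | Choose _ s q => Choose s (fun b => bind (q b) g)
  end.

(** [exec f I p c a]: when the oracles answer according to f and I, the program
    p can (for some resolution of its choices) return a after exactly c calls. *)
Fixpoint exec (R : Type) (T : finType) (f : {set T} -> R) (I : {set {set T}})
    (A : Type) (p : prog R T A) (c : nat) (a : A) : Prop :=
  match p with
  | Ret b => c = 0%N /\ a = b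
  | AskValue X q => exists2 c', c = c'.+1 & exec f I (q (f X)) c' a
  | AskIndep X q => exists2 c', c = c'.+1 & exec f I (q (X \in I)) c' a
  | Choose _ s q => exists2 b, b \in s & exec f I (q b) c a
  end.

Fixpoint collect (R : Type) (T : finType) (B : Type)
    (q : B -> prog R T (option R)) (s : seq B) : prog R T (seq (B * R)) :=
  if s is b :: s' then
    bind (q b) (fun o =>
    bind (collect q s') (fun l =>
    Ret (if o is Some v then (b, v) :: l else l)))
  else Ret [::].

Definition maximizers (R : realFieldType) (B : Type) (l : seq (B * R)) : seq B :=
  [seq x.1 | x <- l & all (fun y : B * R => y.2 <= x.2) l].

(** The marginal gain f(u | S), if S + u is independent and this gain is
    positive. *)
Definition gain (R : realFieldType) (T : finType) (S : {set T}) (u : T) :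
    prog R T (option R) :=
  AskIndep (u |: S) (fun b =>
    if b then
      AskValue (u |: S) (fun v => AskValue S (fun w =>
        Ret (if 0 < v - w then Some (v - w) else None)))
    else Ret None).

(** N is the set of remaining elements, S j the j-th current solution. Each
    iteration removes an element from N, so [#|N|] is always enough fuel:
    when the fuel runs out N is empty and no pair is eligible any more. *)
Fixpoint greedy_loop (R : realFieldType) (T : finType) (l : nat) (fuel : nat)
    (N : {set T}) (S : {ffun 'I_l -> {set T}}) :
    prog R T {ffun 'I_l -> {set T}} :=
  if fuel is fuel'.+1 then
    bind (collect (fun x : T * 'I_l => gain R (S x.2) x.1)
            [seq (u, j) | u <- enum N, j <- enum 'I_l])
      (fun cands =>
        if cands is [::] then Ret S
        else Choose (maximizers cands) (fun x : T * 'I_l =>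
          greedy_loop R fuel' (N :\ x.1)
            [ffun j => if j == x.2 then x.1 |: S j else S j]))
  else Ret S.

Definition simultaneous_greedys (R : realFieldType) (T : finType) (l : nat) :
    prog R T {set T} :=
  bind (greedy_loop R #|T| [set: T] [ffun _ : 'I_l => set0]) (fun S =>
  bind (collect (fun j => AskValue (S j) (fun v => Ret (Some v))) (enum 'I_l))
    (fun vals => Choose (maximizers vals) (fun j => Ret (S j)))).

(* Main.v *)
(** Let F_1, ..., F_l be the final solutions and O an independent set. Along the
    run, keep for each j an independent set B_j, initially O, with
    S_j U (O n F_j) <= B_j <= S_j U (O n N). When u joins S_j, k-extendibility
    evicts at most k elements from B_j, and none if u is in O; every other B_i
    loses at most u, and nothing if u is not in O. With p = max(k, l - 1), at
    most p elements are thus lost at each step, and by greediness the marginal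
    of each on its final solution is at most the gain of that step. The gains
    add up to \sum_j (f(F_j) - f(set0)), so submodularity gives
    \sum_j f(O U F_j) <= (p + 1) \sum_j f(F_j) <= (p + 1) l f(S).
    The left-hand side is at least (l - 1) f(O) because the F_j are disjoint,
    and at least l f(O) when f is monotone. *)
Require Import Defs.
From HB Require Import structures.
From mathcomp Require Import all_boot all_order all_algebra.
From mathcomp Require Import zify ring lra.

Set Implicit Arguments.
Unset Strict Implicit.
Unset Printing Implicit Defensive.

Import Order.TTheory GRing.Theory Num.Theory.
Local Open Scope ring_scope.

Section SetFacts.

Variable T : finType.
Implicit Types (A B C : {set T}) (x : T).

Lemma disjointsU1 x A B : [disjoint x |: A & B] = (x \notin B) && [disjoint A & B].
Proof. by rewrite -!setI_eq0 setIUl setU_eq0 !setI_eq0 disjoints1. Qed.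

Lemma disjoints_setD A B : [disjoint A :\: B & B].
Proof. by rewrite disjoints_subset setDE subsetIr. Qed.

Definition disjoint_family (J : finType) (F : J -> {set T}) : Prop :=
  forall i j, i != j -> [disjoint F i & F j].

Lemma set_ind (P : {set T} -> Prop) :
  P set0 -> (forall x A, x \notin A -> P A -> P (x |: A)) -> forall A, P A.
Proof.
move=> P0 PU A; elim: {A}_.+1 {-2}A (ltnSn #|A|) => // n IHn A.
have [->//|[x xA]] := set_0Vmem A; rewrite (cardsD1 x) xA => /IHn PAx.
by rewrite -(setD1K xA); apply: PU PAx; rewrite setD11.
Qed.

Lemma ler_sum_setD (R : numDomainType) (w : T -> R) g A B C :
  0 <= g -> {in A :\: C, forall x, w x <= g} -> B :\: C \subset A ->
  \sum_(x in A :\: C) w x <= \sum_(x in B :\: C) w x + #|A :\: B|%:R * g.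
Proof.
move=> g_ge0 wg BCA; rewrite (big_setID (B :\: C)) /= (setIidPr _); last first.
  by rewrite subsetD BCA disjoints_setD.
rewrite lerD2l; apply: (@le_trans _ _ (\sum_(x in (A :\: C) :\: (B :\: C)) g)).
  by apply: ler_sum => x /setDP[/wg].
rewrite sumr_const -(mulr_natl g) ler_wpM2r // ler_nat subset_leq_card //.
rewrite setDDr disjoint_setI0 ?disjoints_setD // setU0.
exact: setSD (subsetDl A C).
Qed.

End SetFacts.

Section Systems.

Variables (T : finType) (I : {set {set T}}).

Lemma card_le_rank (A : {set T}) : A \in I -> (#|A| <= rank I)%N.
Proof. exact: (leq_bigmax_cond (F := fun B : {set T} => #|B|)). Qed.

Lemma independence_system_set0 : independence_system I -> set0 \in I.
Proof. by case=> /set0Pn[A AI] /(_ _ _ (sub0set A) AI). Qed.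

End Systems.

Definition marginal (R : zmodType) (T : finType) (f : {set T} -> R)
    (S : {set T}) (u : T) : R :=
  f (u |: S) - f S.

Section Submodular.

Variables (R : realFieldType) (T : finType) (f : {set T} -> R).
Hypothesis fsub : submodular f.

Implicit Types (A B O S : {set T}) (u : T).

Lemma submodular_marginal A B u :
  A \subset B -> u \notin B -> marginal f B u <= marginal f A u.
Proof.
move=> AB uB; rewrite /marginal; have := fsub (u |: A) B.
have -> : u |: A :|: B = u |: B by rewrite -setUA (setUidPr AB).
have -> : (u |: A) :&: B = A.
  by rewrite setIUl (setIidPl AB) (disjoint_setI0 _) ?set0U // disjoints1.
lra.
Qed.

Lemma submodular_sum_marginals O S :
  f (O :|: S) - f S <= \sum_(o in O :\: S) marginal f S o.
Proof.
have -> : O :|: S = (O :\: S) :|: S.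
  by apply/setP => x; rewrite !inE; case: (x \in S); rewrite ?orbT.
have: [disjoint O :\: S & S] by apply: disjoints_setD.
elim/set_ind: (O :\: S) => [|x A xA IHA]; first by rewrite set0U big_set0 subrr.
rewrite disjointsU1 => /andP[xS /IHA le_A].
rewrite (big_setU1 _ xA) /= -setUA.
have /(submodular_marginal (subsetUr A S)) : x \notin A :|: S.
  by rewrite inE negb_or xA.
rewrite /marginal in le_A *; lra.
Qed.

Lemma submodular_disjoint_unions (J : finType) (F : J -> {set T}) (A : {set J}) O :
  disjoint_family F ->
  #|A|%:R * f O + f (O :|: \bigcup_(j in A) F j)
    <= \sum_(j in A) f (O :|: F j) + f O.
Proof.
move=> dF; elim/set_ind: A => [|j A jA IHA].
  by rewrite cards0 !big_set0 setU0 mul0r.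
rewrite !big_setU1 //= cardsU1 jA add1n -natr1.
have := fsub (O :|: F j) (O :|: \bigcup_(i in A) F i).
rewrite -setUUr -setUIr (disjoint_setI0 _) ?setU0; first by lra.
by apply: bigcup_disjoint => i iA; apply: dF; apply: contraNneq jA => ->.
Qed.

End Submodular.

Lemma maximizers_max (R : realFieldType) (B : eqType) (s : seq (B * R)) x :
  x \in maximizers s -> exists2 v, (x, v) \in s & forall y, y \in s -> y.2 <= v.
Proof.
case/mapP=> -[y v]; rewrite mem_filter /= => /andP[/allP vmax ys ->].
by exists v.
Qed.

Lemma maximizers_exists (R : realFieldType) (B : eqType) (s : seq (B * R)) :
  s != [::] -> exists x, x \in maximizers s.
Proof.
case: s => // z s _; pose value (i : 'I_(size s).+1) := (nth z (z :: s) i).2.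
have [i _ imax] := arg_maxP (i0 := ord0) (P := predT) value isT.
exists (nth z (z :: s) i).1; apply: map_f.
rewrite mem_filter mem_nth ?andbT //; apply/(all_nthP z) => j js.
exact: (imax (Ordinal js)).
Qed.

Section WeakestPrecondition.

Variables (R : realFieldType) (T : finType).
Variables (f : {set T} -> R) (I : {set {set T}}).

(* [wp p Q]: whatever the choices, p terminates with a result and a number of
   oracle calls satisfying Q, never choosing from an empty list. *)
Fixpoint wp (A : Type) (p : prog R T A) (Q : nat -> A -> Prop) : Prop :=
  match p with
  | Ret a => Q 0%N a
  | AskValue X q => wp (q (f X)) (fun c => Q c.+1)
  | AskIndep X q => wp (q (X \in I)) (fun c => Q c.+1)
  | Choose _ s q => (exists b, b \in s) /\ forall b, b \in s -> wp (q b) Q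
  end.

Lemma wp_mono A (p : prog R T A) (P Q : nat -> A -> Prop) :
  (forall c a, P c a -> Q c a) -> wp p P -> wp p Q.
Proof.
elim: p P Q => [a|X q IH|X q IH|E s q IH] P Q PQ /=; first exact: PQ.
- by apply: IH => c; apply: PQ.
- by apply: IH => c; apply: PQ.
- by case=> s_ex wpq; split=> // b /wpq; apply: IH.
Qed.

Lemma wp_bind A B (p : prog R T A) (g : A -> prog R T B) Q :
  wp p (fun c a => wp (g a) (fun c' => Q (c + c')%N)) -> wp (bind p g) Q.
Proof.
elim: p Q => [a|X q IH|X q IH|E s q IH] Q //=; try exact: IH.
by case=> s_ex wpq; split=> // b /wpq; apply: IH.
Qed.

Lemma wp_exec_exists A (p : prog R T A) Q :
  wp p Q -> exists c a, exec f I p c a.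
Proof.
elim: p Q => [a|X q IH|X q IH|E s q IH] Q /=; first by exists 0%N, a.
- by case/IH=> c [a qa]; exists c.+1, a, c.
- by case/IH=> c [a qa]; exists c.+1, a, c.
- by case=> -[b sb] /(_ b sb) /IH [c [a qa]]; exists c, a, b.
Qed.

Lemma wp_exec A (p : prog R T A) Q c a : wp p Q -> exec f I p c a -> Q c a.
Proof.
elim: p Q c => [b|X q IH|X q IH|E s q IH] Q c /=; first by move=> Qb [-> ->].
- by move=> wpq [c' -> qa]; apply: (IH _ _ _ wpq qa).
- by move=> wpq [c' -> qa]; apply: (IH _ _ _ wpq qa).
- by case=> _ wpq [b /wpq wpb qa]; apply: (IH _ _ _ wpb qa).
Qed.

Definition computes A (p : prog R T A) (m : nat) (a : A) : Prop :=
  wp p (fun c b => (c <= m)%N /\ b = a).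

Lemma computes_collect B (q : B -> prog R T (option R)) m h s :
  (forall b, computes (q b) m (h b)) ->
  computes (collect q s) (m * size s) (pmap (fun b => omap (pair b) (h b)) s).
Proof.
move=> qh; elim: s => [//|b s IHs] /=.
apply: wp_bind; apply: wp_mono (qh b) => c1 _ [le_c1 ->].
apply: wp_bind; apply: wp_mono IHs => c2 _ [le_c2 ->] /=.
by rewrite addn0 mulnS leq_add //; case: (h b).
Qed.

End WeakestPrecondition.

Section Runs.

Variables (R : realFieldType) (T : finType).
Variables (f : {set T} -> R) (I : {set {set T}}) (l : nat).

Implicit Types (N : {set T}) (S F : {ffun 'I_l -> {set T}}).
Implicit Types (u : T) (i j : 'I_l).

Definition add_to S u j : {ffun 'I_l -> {set T}} :=
  [ffun i => if i == j then u |: S i else S i].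

Definition empty_solutions : {ffun 'I_l -> {set T}} := [ffun=> set0].

Definition improving (A : {set T}) u : bool :=
  (u |: A \in I) && (0 < marginal f A u).

Definition greedy_choice N S u j : Prop :=
  [/\ u \in N, improving (S j) u
    & forall v i, v \in N -> improving (S i) v ->
        marginal f (S i) v <= marginal f (S j) u].

(* [greedy_run m N S F]: with remaining elements N and current solutions S, m
   further iterations lead to the final solutions F. *)
Inductive greedy_run : nat -> {set T} -> {ffun 'I_l -> {set T}} ->
    {ffun 'I_l -> {set T}} -> Prop :=
| run_stop N S :
    (forall u j, u \in N -> ~~ improving (S j) u) -> greedy_run 0 N S S
| run_step m N S F u j :
    greedy_choice N S u j -> greedy_run m (N :\ u) (add_to S u j) F ->
    greedy_run m.+1 N S F.

(* The final solutions are pairwise disjoint because every element leaves N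
   when it is added. *)
Definition separated N S : Prop :=
  (forall i, [disjoint S i & N]) /\ disjoint_family S.

Lemma add_toE S u j i : add_to S u j i = if i == j then u |: S i else S i.
Proof. by rewrite ffunE. Qed.

Lemma sub_add_to S u j i : S i \subset add_to S u j i.
Proof. by rewrite add_toE; case: ifP => // _; apply: subsetUr. Qed.

Lemma big_add_to (V : Type) (idx : V) (op : Monoid.com_law idx)
    (h : {set T} -> V) S u j :
  \big[op/idx]_i h (add_to S u j i) =
    op (h (u |: S j)) (\big[op/idx]_(i | i != j) h (S i)).
Proof.
rewrite (bigD1 j) //= add_toE eqxx; congr (op _ _).
by apply: eq_bigr => i /negbTE ij; rewrite add_toE ij.
Qed.

Lemma separated_empty : separated setT empty_solutions.
Proof. by split=> [i|i j _]; rewrite ffunE -setI_eq0 set0I. Qed.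

Lemma separated_notin N S u i : separated N S -> u \in N -> u \notin S i.
Proof. by case=> dSN _ uN; rewrite (disjointFl (dSN i) uN). Qed.

Lemma separated_add N S u j :
  separated N S -> u \in N -> separated (N :\ u) (add_to S u j).
Proof.
move=> sepS uN; have uS i := separated_notin i sepS uN.
case: sepS => dSN dS; split=> [i|a b ab]; rewrite !add_toE.
  have dSNu : [disjoint S i & N :\ u] := disjointWr (subD1set N u) (dSN i).
  by case: ifP => // _; rewrite disjointsU1 !inE eqxx.
have [aj|_] := eqVneq a j; have [bj|_] := eqVneq b j; last exact: dS.
- by rewrite aj bj eqxx in ab.
- by rewrite disjointsU1 uS dS.
- by rewrite disjoint_sym disjointsU1 uS dS // eq_sym.
Qed.

Lemma greedy_choice_max N S u j v i :
  greedy_choice N S u j -> v \in N -> v |: S i \in I ->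
  marginal f (S i) v <= marginal f (S j) u.
Proof.
case=> _ /andP[_ u_pos] umax vN vI; have [v_neg|v_pos] := leP (marginal f (S i) v) 0.
  exact: le_trans v_neg (ltW u_pos).
by apply: umax => //; rewrite /improving vI.
Qed.

Lemma greedy_run_sub m N S F i : greedy_run m N S F -> S i \subset F i.
Proof.
elim=> [//|{}m {}N {}S {}F u j _ _].
exact: subset_trans (sub_add_to S u j i).
Qed.

Lemma greedy_run_indep m N S F :
  greedy_run m N S F -> (forall i, S i \in I) -> forall i, F i \in I.
Proof.
elim=> [//|{}m {}N {}S {}F u j [_ /andP[uI _] _] _ IH SI].
by apply: IH => i; rewrite add_toE; case: eqP => [->|].
Qed.

Lemma greedy_run_empty_indep m F :
  independence_system I -> greedy_run m setT empty_solutions F ->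
  forall i, F i \in I.
Proof.
move=> Isys runF; apply: (greedy_run_indep runF) => i.
by rewrite ffunE independence_system_set0.
Qed.

Lemma greedy_run_disjoint m N S F :
  greedy_run m N S F -> separated N S -> disjoint_family F.
Proof.
elim=> [{}N {}S _ []//|{}m {}N {}S {}F u j [uN _ _] _ IH sepS].
exact/IH/separated_add.
Qed.

Lemma greedy_run_card m N S F :
  greedy_run m N S F -> separated N S -> (\sum_i #|F i| = m + \sum_i #|S i|)%N.
Proof.
elim=> [//|{}m {}N {}S {}F u j [uN _ _] _ IH sepS].
rewrite IH; last exact: separated_add.
rewrite (big_add_to _ (fun A : {set T} => #|A|)) [in RHS](bigD1 j) //=.
by rewrite cardsU1 (separated_notin j sepS uN) addSnnS.
Qed.

Lemma greedy_run_steps_le m F :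
  independence_system I -> greedy_run m setT empty_solutions F ->
  (m <= l * rank I)%N.
Proof.
move=> Isys runF; have FI := greedy_run_empty_indep Isys runF.
have := greedy_run_card runF separated_empty.
rewrite [X in (m + X)%N]big1 ?addn0 => [<-|i _]; last by rewrite ffunE cards0.
rewrite -[l in (l * _)%N]card_ord -sum_nat_const.
by apply: leq_sum => i _; apply: card_le_rank.
Qed.

End Runs.

Section Algorithm.

Variables (R : realFieldType) (T : finType).
Variables (f : {set T} -> R) (I : {set {set T}}) (l : nat).

Implicit Types (N : {set T}) (S F : {ffun 'I_l -> {set T}}).

Definition positive_gain (A : {set T}) (u : T) : option R :=
  if improving f I A u then Some (marginal f A u) else None.

Definition candidates N S : seq (T * 'I_l * R) :=
  pmap (fun x => omap (pair x) (positive_gain (S x.2) x.1))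
    [seq (u, j) | u <- enum N, j <- enum 'I_l].

Definition final_values F : seq ('I_l * R) :=
  pmap (fun j => omap (pair j) (Some (f (F j)))) (enum 'I_l).

(* Each of the m + 1 passes over the pairs (u, j) costs at most three calls per
   pair, and comparing the final solutions costs l calls. *)
Definition greedy_outcome (c : nat) (S : {set T}) : Prop :=
  exists m F j,
    [/\ greedy_run f I m setT (empty_solutions T l) F,
        (c <= 3 * (#|T| * l) * m.+1 + l)%N, S = F j
      & forall i, f (F i) <= f S].

Lemma computes_gain (A : {set T}) (u : T) :
  computes f I (gain R A u) 3 (positive_gain A u).
Proof.
rewrite /computes /positive_gain /improving /marginal /=.
by case: (u |: A \in I) => /=.
Qed.

Lemma computes_candidates N S :
  computes f I
    (collect (fun x : T * 'I_l => gain R (S x.2) x.1)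
       [seq (u, j) | u <- enum N, j <- enum 'I_l])
    (3 * (#|N| * l)) (candidates N S).
Proof.
have -> : (#|N| * l)%N = size [seq (u, j) | u <- enum N, j <- enum 'I_l].
  by rewrite size_allpairs -cardE size_enum_ord.
by apply: computes_collect => x; apply: computes_gain.
Qed.

Lemma computes_final_values F :
  computes f I
    (collect (fun j => AskValue (F j) (fun v => Ret (Some v))) (enum 'I_l))
    l (final_values F).
Proof.
rewrite -[l in computes _ _ _ l]mul1n -[X in (1 * X)%N]size_enum_ord.
exact: computes_collect.
Qed.

Lemma mem_candidates N S u j v :
  ((u, j, v) \in candidates N S) =
    [&& u \in N, improving f I (S j) u & v == marginal f (S j) u].
Proof.
rewrite mem_pmap; apply/mapP/and3P => [[x /allpairsP[[w i]]]|].
  rewrite /= !mem_enum => -[wN _ ->] /=; rewrite /positive_gain.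
  by case: ifP => //= impr [-> -> ->].
case=> uN impr /eqP ->; exists (u, j); last by rewrite /positive_gain /= impr.
by apply/allpairsP; exists (u, j); rewrite !mem_enum.
Qed.

Lemma mem_final_values F j v : ((j, v) \in final_values F) = (v == f (F j)).
Proof.
rewrite mem_pmap; apply/mapP/eqP => [[i _ [-> ->]] //|->].
by exists j; rewrite ?mem_enum.
Qed.

Lemma candidates_nil N S :
  candidates N S = [::] -> forall u j, u \in N -> ~~ improving f I (S j) u.
Proof.
move=> cands0 u j uN; have := mem_candidates N S u j (marginal f (S j) u).
by rewrite cands0 uN eqxx andbT /= => <-.
Qed.

Lemma maximizers_candidates N S u j :
  (u, j) \in maximizers (candidates N S) -> greedy_choice f I N S u j.
Proof.
case/maximizers_max=> v; rewrite mem_candidates => /and3P[uN impr /eqP ->] umax.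
split=> // w i wN wimpr; apply: (umax (w, i, _)).
by rewrite mem_candidates wN wimpr /=.
Qed.

Lemma wp_greedy_loop fuel N S : (#|N| <= fuel)%N ->
  wp f I (greedy_loop R fuel N S) (fun c F =>
    exists2 m, greedy_run f I m N S F & (c <= 3 * (#|T| * l) * m.+1)%N).
Proof.
elim: fuel N S => [|fuel IH] N S /=.
  rewrite leqn0 cards_eq0 => /eqP ->; exists 0%N => //.
  by apply: run_stop => u j; rewrite inE.
move=> leN; apply: wp_bind.
apply: wp_mono (computes_candidates N S) => c _ [le_c ->].
have {}le_c : (c <= 3 * (#|T| * l))%N.
  by apply: leq_trans le_c _; rewrite leq_mul2l leq_mul2r max_card orbT.
case candsE: (candidates N S) => [|x s] /=.
  exists 0%N; last by rewrite addn0 muln1.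
  exact/run_stop/candidates_nil.
have cands_neq0 : candidates N S != [::] by rewrite candsE.
rewrite -{x s}candsE; split; first exact: maximizers_exists.
case=> u j /maximizers_candidates choice_uj /=.
have leNu : (#|N :\ u| <= fuel)%N.
  by case: choice_uj leN => uN _ _; rewrite (cardsD1 u N) uN.
apply: wp_mono (IH _ _ leNu) => c' F [m runF le_c'].
exists m.+1; first exact: run_step runF.
by rewrite mulnS leq_add.
Qed.

Lemma wp_simultaneous_greedys :
  (0 < l)%N -> wp f I (simultaneous_greedys R T l) greedy_outcome.
Proof.
move=> l_gt0; apply: wp_bind.
have leT : (#|[set: T]| <= #|T|)%N by rewrite cardsT.
apply: wp_mono (wp_greedy_loop _ leT) => c1 F [m runF le_c1].
apply: wp_bind; apply: wp_mono (computes_final_values F) => c2 _ [le_c2 ->] /=.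
split=> [|j /maximizers_max[v]].
  apply: maximizers_exists; apply: contraTneq (eqxx (f (F (Ordinal l_gt0)))).
  by rewrite -mem_final_values => ->.
rewrite mem_final_values => /eqP -> jmax.
exists m, F, j; split; rewrite ?addn0 ?leq_add // => i.
by apply: (jmax (i, f (F i))); rewrite mem_final_values.
Qed.

End Algorithm.

Section Completions.

Variables (T : finType) (I : {set {set T}}) (k : nat).
Hypothesis Iext : k_extendible k I.

Implicit Types (O N F S B : {set T}) (u : T).

(* B is what is left of the comparison set O, together with the current
   solution S; the part of O that lies in the final solution F is never evicted. *)
Definition completion O N F S B : Prop :=
  [/\ S :|: O :&: F \subset B, B \subset S :|: O :&: N & B \in I].

Lemma completion_setT O F : O \in I -> completion O setT F set0 O.
Proof. by move=> OI; split; rewrite // ?setIT set0U // subsetIl. Qed.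

Lemma completion_addable O N F S B u :
  completion O N F S B -> u \in B -> u \notin S -> u \in N /\ u |: S \in I.
Proof.
case=> subB Bsub BI uB uS; split.
  by have := subsetP Bsub u uB; rewrite !inE (negbTE uS) => /andP[].
apply: Iext.1.2 BI; rewrite subUset sub1set uB.
exact: subset_trans (subsetUl _ _) subB.
Qed.

Lemma completion_skip O N F S B u :
  u \notin S -> u \notin F -> completion O N F S B ->
  completion O (N :\ u) F S (B :\ u).
Proof.
move=> uS uF [subB Bsub BI]; split.
- by rewrite subsetD1 subB !inE negb_or uS negb_and uF orbT.
- apply/subsetP => x; rewrite !inE => /andP[-> /(subsetP Bsub)].
  by rewrite !inE.
- exact: Iext.1.2 (subD1set B u) BI.
Qed.

Lemma completion_add O N F S B u :
  u \in N -> u \notin S -> u |: S \subset F -> F \in I ->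
  completion O N F S B ->
  exists B', [/\ completion O (N :\ u) F (u |: S) B', B' :\: F \subset B
    & (#|B :\: B'| <= if u \in O then 0 else k)%N].
Proof.
move=> uN uS uSF FI [subB Bsub BI].
have uF : u \in F by move: uSF; rewrite subUset sub1set => /andP[].
have Bsub' : B \subset u |: S :|: O :&: (N :\ u).
  apply/subsetP => x /(subsetP Bsub); rewrite !inE.
  by case: eqP => //= _ ->.
case: ifPn => uO.
  exists B; rewrite setDv cards0 subsetDl; do 2?split=> //.
  have uB : u \in B by apply: (subsetP subB); rewrite !inE uO uF orbT.
  by rewrite -setUA subUset sub1set uB.
have uB : u \notin B.
  by apply/negP => /(subsetP Bsub); rewrite !inE (negbTE uS) (negbTE uO).
have uSOI : u |: (S :|: O :&: F) \in I.
  by apply: Iext.1.2 FI; rewrite setUA subUset uSF subsetIr.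
have [Y [Ysub Ycard YI]] := Iext.2 _ _ _ subB BI uB uSOI.
exists (u |: (B :\: Y)); split; first split=> //.
- rewrite -setUA setUS //; apply/subsetP => x xSO; rewrite inE (subsetP subB) //.
  by rewrite andbT; apply/negP => /(subsetP Ysub); rewrite inE xSO.
- rewrite subUset sub1set !inE eqxx /=.
  exact: subset_trans (subsetDl B Y) Bsub'.
- apply/subsetP => x; rewrite !inE.
  by case: eqP => [->|_]; rewrite ?uF // => /and3P[].
- apply: leq_trans Ycard; apply/subset_leq_card/subsetP => x.
  by rewrite !inE negb_or negb_and negbK => /andP[/andP[_ /orP[//|/negP]]].
Qed.

Variables (l p : nat).
Hypotheses (le_kp : (k <= p)%N) (le_lp : (l <= p.+1)%N).

Lemma completions_add_to O N (S F : {ffun 'I_l -> {set T}}) (B : 'I_l -> {set T}) u j :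
  u \in N -> separated N S -> (forall i, add_to S u j i \subset F i) ->
  disjoint_family F -> F j \in I ->
  (forall i, completion O N (F i) (S i) (B i)) ->
  exists B' : 'I_l -> {set T},
    [/\ forall i, completion O (N :\ u) (F i) (add_to S u j i) (B' i),
        forall i, B' i :\: F i \subset B i
      & (\sum_i #|B i :\: B' i| <= p)%N].
Proof.
move=> uN sepS subF dF FI BO; have uS i := separated_notin i sepS uN.
have uSF : u |: S j \subset F j by have := subF j; rewrite add_toE eqxx.
have uF i : i != j -> u \notin F i.
  move=> ij; rewrite (disjointFl (dF _ _ ij)) //.
  by apply: (subsetP uSF); rewrite setU11.
have [Bj [BjO subBj cardBj]] := completion_add uN (uS j) uSF FI (BO j).
exists (fun i => if i == j then Bj else B i :\ u); split=> [i|i|].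
- rewrite add_toE; case: eqP => [->//|/eqP ij].
  exact: completion_skip (uS i) (uF i ij) (BO i).
- case: eqP => [->//|_].
  by rewrite setDDl; apply: subsetDl.
rewrite (bigD1 j) //= eqxx.
have lost i : i != j ->
    (#|B i :\: (if i == j then Bj else B i :\ u)| <= (u \in O))%N.
  move=> /negbTE ->; rewrite setDDr setDv set0U.
  have [uO|uO] := boolP (u \in O).
    by rewrite /= -(cards1 u) subset_leq_card // subsetIr.
  rewrite leqn0 cards_eq0 setI_eq0 disjoint_sym disjoints1.
  case: (BO i) => _ Bsub _; apply/negP => /(subsetP Bsub).
  by rewrite !inE (negbTE (uS i)) (negbTE uO).
apply: leq_trans (leq_add cardBj (leq_sum _ lost)) _.
rewrite sum_nat_const cardC1 card_ord.
by case: (u \in O); rewrite ?muln1 ?muln0; lia.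
Qed.

End Completions.

Section Charging.

Variables (R : realFieldType) (T : finType).
Variables (f : {set T} -> R) (I : {set {set T}}) (k l p : nat).
Hypotheses (fsub : submodular f) (f_ge0 : nonnegative f).
Hypothesis Iext : k_extendible k I.
Hypotheses (le_kp : (k <= p)%N) (le_lp : (l <= p.+1)%N).

Implicit Types (O N : {set T}) (S F : {ffun 'I_l -> {set T}}).

Lemma greedy_run_charging m N S F O (B : 'I_l -> {set T}) :
  greedy_run f I m N S F -> separated N S -> (forall i, F i \in I) ->
  (forall i, completion I O N (F i) (S i) (B i)) ->
  \sum_i \sum_(o in B i :\: F i) marginal f (F i) o <=
    p%:R * \sum_i (f (F i) - f (S i)).
Proof.
move=> runF; elim: runF B => {m N S F}.
  move=> N S stop B _ _ BO; rewrite [X in _ * X]big1 => [|i _]; last exact: subrr.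
  rewrite mulr0; apply: sumr_le0 => i _; apply: sumr_le0 => o /setDP[oB oS].
  have [oN oI] := completion_addable Iext (BO i) oB oS.
  by have := stop o i oN; rewrite /improving oI -leNgt.
move=> m N S F u j choice_uj runF IH B sepS FI BO.
have [uN /andP[_ u_pos] _] := choice_uj.
have subF i := greedy_run_sub i runF.
have dF := greedy_run_disjoint runF (separated_add j sepS uN).
have [B' [B'O subB' lost]] :=
  completions_add_to Iext le_kp le_lp uN sepS subF dF (FI j) BO.
have {}IH := IH B' (separated_add j sepS uN) FI B'O.
have charge i : {in B i :\: F i, forall o, marginal f (F i) o <= marginal f (S j) u}.
  move=> o /setDP[oB oF]; have SF := subset_trans (sub_add_to S u j i) (subF i).
  apply: le_trans (submodular_marginal fsub SF oF) _.
  have oS : o \notin S i by apply: contra oF; apply: (subsetP SF).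
  have [oN oI] := completion_addable Iext (BO i) oB oS.
  exact: greedy_choice_max choice_uj oN oI.
have le_i i : \sum_(o in B i :\: F i) marginal f (F i) o <=
    \sum_(o in B' i :\: F i) marginal f (F i) o
    + #|B i :\: B' i|%:R * marginal f (S j) u.
  exact: ler_sum_setD (ltW u_pos) (charge i) (subB' i).
apply: le_trans (ler_sum _ (fun i _ => le_i i)) _.
rewrite big_split /= -mulr_suml -natr_sum.
have -> : \sum_i (f (F i) - f (S i)) =
    \sum_i (f (F i) - f (add_to S u j i)) + marginal f (S j) u.
  by rewrite !sumrB (big_add_to _ f) [\sum_i f (S i)](bigD1 j) //= /marginal; ring.
by rewrite [leRHS]mulrDr lerD // ler_pM2r // ler_nat.
Qed.

Lemma greedy_run_union_bound m F O :
  O \in I -> greedy_run f I m setT (empty_solutions T l) F ->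
  \sum_i f (O :|: F i) <= p.+1%:R * \sum_i f (F i).
Proof.
move=> OI runF; have FI := greedy_run_empty_indep Iext.1 runF.
have charge : \sum_i \sum_(o in O :\: F i) marginal f (F i) o <=
    p%:R * \sum_i (f (F i) - f (empty_solutions T l i)).
  apply: (greedy_run_charging runF) => // [|i]; first exact: separated_empty.
  by rewrite ffunE; apply: completion_setT.
have marginals : \sum_i (f (O :|: F i) - f (F i)) <=
    \sum_i \sum_(o in O :\: F i) marginal f (F i) o.
  by apply: ler_sum => i _; apply: submodular_sum_marginals.
have drop0 : p%:R * \sum_i (f (F i) - f (empty_solutions T l i)) <=
    p%:R * \sum_i f (F i).
  by rewrite ler_wpM2l //; apply: ler_sum => i _; rewrite lerBlDr lerDl.
have := le_trans marginals (le_trans charge drop0).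
by rewrite sumrB -natr1; lra.
Qed.

Lemma greedy_outcome_union_bound c (S : {set T}) O :
  O \in I -> greedy_outcome f I l c S ->
  exists2 F : 'I_l -> {set T}, disjoint_family F &
    \sum_i f (O :|: F i) <= p.+1%:R * (l%:R * f S).
Proof.
move=> OI [m [F [_ [runF _ _ Smax]]]]; exists F.
  exact: greedy_run_disjoint runF (separated_empty T l).
apply: le_trans (greedy_run_union_bound OI runF) _.
rewrite ler_pM2l ?ltr0Sn // mulr_natl -[l in _ *+ l]card_ord -sumr_const.
exact: ler_sum.
Qed.

Lemma greedy_outcome_ratio c (S : {set T}) O :
  O \in I -> greedy_outcome f I l c S ->
  (l%:R - 1) * f O <= p.+1%:R * (l%:R * f S).
Proof.
move=> OI /(greedy_outcome_union_bound OI) [F dF le_sum].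
have := submodular_disjoint_unions fsub [set: 'I_l] O dF.
rewrite cardsT card_ord [\sum_(j in _) _](eq_bigl xpredT) => [|j]; last first.
  exact: in_setT.
have := f_ge0 (O :|: \bigcup_(j in [set: 'I_l]) F j); move: le_sum; lra.
Qed.

Lemma greedy_outcome_monotone_ratio c (S : {set T}) O :
  monotone f -> O \in I -> greedy_outcome f I l c S -> f O <= p.+1%:R * f S.
Proof.
move=> fmono OI outS; have [F _ le_sum] := greedy_outcome_union_bound OI outS.
have l_gt0 : 0 < l%:R :> R.
  by case: outS => m [_ [j _]]; rewrite ltr0n (leq_trans _ (ltn_ord j)).
rewrite -(ler_pM2l l_gt0) mulrCA; apply: le_trans le_sum.
rewrite mulr_natl -[l in _ *+ l]card_ord -sumr_const.
by apply: ler_sum => i _; apply/fmono/subsetUl.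
Qed.

End Charging.

Section Outcome.

Variables (R : realFieldType) (T : finType).
Variables (f : {set T} -> R) (I : {set {set T}}) (l : nat).
Hypothesis Isys : independence_system I.

Lemma greedy_outcome_indep c S : greedy_outcome f I l c S -> S \in I.
Proof.
by case=> m [F [j [runF _ -> _]]]; apply: greedy_run_empty_indep runF j.
Qed.

Lemma greedy_outcome_calls c S :
  greedy_outcome f I l c S -> (c <= 3 * (#|T| * l) * (l * rank I).+1 + l)%N.
Proof.
case=> m [F [j [runF le_c _ _]]]; apply: leq_trans le_c _.
rewrite leq_add2r leq_mul2l ltnS orbC.
by rewrite (greedy_run_steps_le Isys runF).
Qed.

End Outcome.

Lemma greedy_calls_le (k r n : nat) : (0 < k)%N -> (0 < r)%N -> (0 < n)%N ->
  (3 * (n * k.+1) * (k.+1 * r).+1 + k.+1 <= 20 * (k ^ 2 * r * n))%N.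
Proof.
move=> k_gt0 r_gt0 n_gt0.
have le_k : (k.+1 <= 2 * k)%N by lia.
have le_kr : ((k.+1 * r).+1 <= 3 * (k * r))%N by nia.
have le_passes :
    (3 * (n * k.+1) * (k.+1 * r).+1 <= 3 * (n * (2 * k)) * (3 * (k * r)))%N.
  by rewrite leq_mul // !leq_mul2l le_k orbT.
have le_krn : (k <= k * (k * r * n))%N.
  by rewrite leq_pmulr // !muln_gt0 k_gt0 r_gt0.
rewrite -mulnn; lia.
Qed.

Lemma ratio_excess_le (R : realFieldType) (x : R) :
  1 <= x -> `|(x + 1) ^+ 2 / x - x| <= 3.
Proof.
move=> x_ge1; have x_gt0 : 0 < x by lra.
have -> : (x + 1) ^+ 2 / x - x = 2 + x^-1 by field; lra.
have xV_gt0 : 0 < x^-1 by rewrite invr_gt0.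
have xV_le1 : x^-1 <= 1 by rewrite invf_le1.
by rewrite ger0_norm; lra.
Qed.

Theorem theorem2 :
  (exists C : nat,
    forall (R : realFieldType) (T : finType) (I : {set {set T}})
           (f : {set T} -> R) (k : nat),
      (0 < k)%N ->
      (forall u : T, [set u] \in I) ->
      k_extendible k I ->
      nonnegative f ->
      submodular f ->
      (exists c S, exec f I (simultaneous_greedys R T k.+1) c S) /\
      (forall (c : nat) (S : {set T}),
        exec f I (simultaneous_greedys R T k.+1) c S ->
        [/\ (0 < #|T|)%N -> (c <= C * (k ^ 2 * rank I * #|T|))%N,
            S \in I,
            forall OPT, is_opt f I OPT ->
              f S >= k%:R / (k%:R + 1) ^+ 2 * f OPT
          & monotone f ->
            forall OPT, is_opt f I OPT -> f S >= f OPT / (k%:R + 1)]))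
  /\
  (exists C : nat,
    forall (R : realFieldType) (k : nat), (0 < k)%N ->
      `|(k%:R + 1) ^+ 2 / k%:R - k%:R| <= C%:R :> R).
Proof.
split; last by exists 3%N => R k k_gt0; rewrite ratio_excess_le // ler1n.
exists 20%N => R T I f k k_gt0 I1 Iext f_ge0 fsub.
have spec := wp_simultaneous_greedys f I (ltn0Sn k).
split=> [|c S /(wp_exec spec) outS]; first exact: wp_exec_exists spec.
have den_gt0 : 0 < k%:R + 1 :> R by rewrite ltr_wpDl ?ler0n.
split=> [T_gt0||OPT [OI _]|fmono OPT [OI _]].
- apply: leq_trans (greedy_outcome_calls Iext.1 outS) (greedy_calls_le _ _ _) => //.
  by have /card_gt0P[u _] := T_gt0; rewrite -(cards1 u) card_le_rank.
- exact: (greedy_outcome_indep Iext.1 outS).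
- have := greedy_outcome_ratio fsub f_ge0 Iext (leqnn k) (leqnn k.+1) OI outS.
  rewrite mulrAC ler_pdivrMr ?exprn_gt0 // -natr1; lra.
- have := greedy_outcome_monotone_ratio fsub f_ge0 Iext (leqnn k) (leqnn k.+1)
    fmono OI outS.
  by rewrite ler_pdivrMr // -natr1 mulrC.
Qed.
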